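(* Let $\mathscr{C}$ be an exact naturally Mal'tsev category with coequalizers. Let $\mathbb{C}$ be a double groupoid in $\mathscr{C}$, with underlying double reflexive graph given by objects $C^i_j$ ($i,j\in\{0,1\}$), horizontal morphisms $d^i,c^i\colon C^i_1\to C^i_0$, $e^i\colon C^i_0\to C^i_1$ and vertical morphisms $d_j,c_j\colon C^1_j\to C^0_j$, $e_j\colon C^0_j\to C^1_j$. Let $\mathbb{F}=\mathsf{F}(\mathbb{C})$ be its reflection in $2\text{-}\mathrm{Grpd}(\mathscr{C})$, with unit $\eta_{\mathbb{C}}\colon\mathbb{C}\to\mathbb{F}$, where $\mathsf{F}\colon\mathrm{Grpd}^2(\mathscr{C})\to 2\text{-}\mathrm{Grpd}(\mathscr{C})$ is the reflector. Then the two internal functors $$\big((\eta_{\mathbb{C}})^0_0,(\eta_{\mathbb{C}})^1_0\big)\colon (C^1_0\rightrightarrows C^0_0)\to(F^1_0\rightrightarrows F^0_0),\qquad \big((\eta_{\mathbb{C}})^0_1,(\eta_{\mathbb{C}})^1_1\big)\colon (C^1_1\rightrightarrows C^0_1)\to(F^1_1\rightrightarrows F^0_0)$$ between the vertical groupoids (with domain/codomain pairs $(d_0,c_0)$, $(\delta_0,\gamma_0)$ and $(d_1,c_1)$, $(\delta_1,\gamma_1)$ respectively) are both discrete fibrations, in the sense that all four commutative squares $$\delta_0(\eta_{\mathbb{C}})^1_0=(\eta_{\mathbb{C}})^0_0d_0,\quad \gamma_0(\eta_{\mathbb{C}})^1_0=(\eta_{\mathbb{C}})^0_0c_0,\quad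 \delta_1(\eta_{\mathbb{C}})^1_1=(\eta_{\mathbb{C}})^0_1d_1,\quad \gamma_1(\eta_{\mathbb{C}})^1_1=(\eta_{\mathbb{C}})^0_1c_1$$ are pullbacks.
   Context: Exact category (in the sense of Barr): a finitely complete category with coequalizers of kernel pairs, pullback-stable regular epimorphisms, and in which every internal equivalence relation is a kernel pair. Naturally Mal'tsev category: a category with (finite) products with a natural transformation $p\colon \mathsf{Id}_{\mathscr{C}}\times\mathsf{Id}_{\mathscr{C}}\times\mathsf{Id}_{\mathscr{C}}\to\mathsf{Id}_{\mathscr{C}}$ such that each component $p_A\colon A\times A\times A\to A$ is an internal Mal'tsev operation, i.e. satisfies $p_A(x,y,y)=x$ and $p_A(x,x,y)=y$. Internal groupoids: $\mathrm{Grpd}(\mathscr{C})$ is the category of internal groupoids in $\mathscr{C}$ and internal functors. An internal groupoid consists of a reflexive graph $d,c\colon C_1\to C_0$, $e\colon C_0\to C_1$ with $de=1_{C_0}=ce$, together with a composition $m\colon C_1\times_{C_0}C_1\to C_1$ and an inverse $i\colon C_1\to C_1$ satisfying the usual axioms. Double groupoids: $\mathrm{Grpd}^2(\mathscr{C}):=\mathrm{Grpd}(\mathrm{Grpd}(\mathscr{C}))$; in the underlying double reflexive graph of a double groupoid, the horizontal and vertical structures commute with each other, and each of the four reflexive graphs underlies an internal groupoid. $2\text{-}\mathrm{Grpd}(\mathscr{C})$ is the full subcategory of $\mathrm{Grpd}^2(\mathscr{C})$ whose objects are the double groupoids for which $e^0\colon C^0_0\to C^0_1$ is an isomorphism. The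 reflector $\mathsf{F}$ and the unit $\eta$ are given as follows. $(F^0_0,(\eta_{\mathbb{C}})^0_0)$ is the coequalizer of $d^0$ and $c^0$; $F^0_1:=F^0_0$ (the bottom horizontal groupoid of $\mathbb{F}$ is discrete, with identity structure maps), and $(\eta_{\mathbb{C}})^0_1:=(\eta_{\mathbb{C}})^0_0d^0=(\eta_{\mathbb{C}})^0_0c^0\colon C^0_1\to F^0_0$. $(F^1_0,(\eta_{\mathbb{C}})^1_0,\varepsilon_0)$ is the pushout of $(\eta_{\mathbb{C}})^0_0$ along $e_0$, with $(\eta_{\mathbb{C}})^1_0\colon C^1_0\to F^1_0$ and $\varepsilon_0\colon F^0_0\to F^1_0$. The morphisms $\delta_0,\gamma_0\colon F^1_0\to F^0_0$ are the unique ones with $\delta_0(\eta_{\mathbb{C}})^1_0=(\eta_{\mathbb{C}})^0_0d_0$, $\delta_0\varepsilon_0=1_{F^0_0}$ and $\gamma_0(\eta_{\mathbb{C}})^1_0=(\eta_{\mathbb{C}})^0_0c_0$, $\gamma_0\varepsilon_0=1_{F^0_0}$. $(F^1_1,(\eta_{\mathbb{C}})^1_1,\varepsilon_1)$ is the pushout of $(\eta_{\mathbb{C}})^0_1$ along $e_1$, with $(\eta_{\mathbb{C}})^1_1\colon C^1_1\to F^1_1$ and $\varepsilon_1\colon F^0_0\to F^1_1$. The morphism $\varepsilon^1\colon F^1_0\to F^1_1$ is the unique one with $\varepsilon^1(\eta_{\mathbb{C}})^1_0=(\eta_{\mathbb{C}})^1_1e^1$ and $\varepsilon^1\varepsilon_0=\varepsilon_1$.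 The morphisms $\delta^1,\gamma^1\colon F^1_1\to F^1_0$ are the unique ones with $\delta^1(\eta_{\mathbb{C}})^1_1=(\eta_{\mathbb{C}})^1_0d^1$, $\delta^1\varepsilon_1=\varepsilon_0$ and $\gamma^1(\eta_{\mathbb{C}})^1_1=(\eta_{\mathbb{C}})^1_0c^1$, $\gamma^1\varepsilon_1=\varepsilon_0$. Finally $\delta_1:=\delta_0\delta^1$ and $\gamma_1:=\gamma_0\gamma^1$. *)

(* Defs.v *)
From Stdlib Require Import ProofIrrelevance.

Set Implicit Arguments.
Unset Strict Implicit.
Unset Printing Implicit Defensive.

Record category := Category {
  Ob :> Type;
  Hom : Ob -> Ob -> Type;
  idm : forall A : Ob, Hom A A;
  comp : forall A B C : Ob, Hom B C -> Hom A B -> Hom A C;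
  comp_idl : forall (A B : Ob) (f : Hom A B), comp (idm B) f = f;
  comp_idr : forall (A B : Ob) (f : Hom A B), comp f (idm A) = f;
  comp_assoc : forall (A B C D : Ob) (h : Hom C D) (g : Hom B C) (f : Hom A B),
    comp h (comp g f) = comp (comp h g) f
}.

Arguments Hom {c} _ _.
Arguments idm {c} _.
Arguments comp {c A B C} _ _.

Notation "g ∘ f" := (comp g f) (at level 40, left associativity).

Section Limits.
Variable C : category.

Definition is_iso (A B : C) (f : Hom A B) : Prop :=
  exists g : Hom B A, g ∘ f = idm A /\ f ∘ g = idm B.

Definition is_terminal (T : C) : Prop :=
  forall X : C, exists! f : Hom X T, True.

Definition is_product (A B P : C) (p1 : Hom P A) (p2 : Hom P B) : Prop :=
  forall (X : C) (x1 : Hom X A) (x2 : Hom X B),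
    exists! u : Hom X P, p1 ∘ u = x1 /\ p2 ∘ u = x2.

Definition is_equalizer (A B E : C) (f g : Hom A B) (e : Hom E A) : Prop :=
  f ∘ e = g ∘ e /\
  forall (X : C) (x : Hom X A), f ∘ x = g ∘ x -> exists! u : Hom X E, e ∘ u = x.

Definition is_coequalizer (A B Q : C) (f g : Hom A B) (q : Hom B Q) : Prop :=
  q ∘ f = q ∘ g /\
  forall (X : C) (x : Hom B X), x ∘ f = x ∘ g -> exists! u : Hom Q X, u ∘ q = x.

Definition is_pullback (A B D P : C)
    (p1 : Hom P A) (p2 : Hom P B) (f : Hom A D) (g : Hom B D) : Prop :=
  f ∘ p1 = g ∘ p2 /\
  forall (X : C) (x1 : Hom X A) (x2 : Hom X B), f ∘ x1 = g ∘ x2 ->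
    exists! u : Hom X P, p1 ∘ u = x1 /\ p2 ∘ u = x2.

Definition is_kernel_pair (R A B : C) (r1 r2 : Hom R A) (f : Hom A B) : Prop :=
  is_pullback r1 r2 f f.

Definition is_regular_epi (A B : C) (f : Hom A B) : Prop :=
  exists (R : C) (r1 r2 : Hom R A), is_coequalizer r1 r2 f.

Definition is_equivalence_relation (R A : C) (r1 r2 : Hom R A) : Prop :=
  (forall (X : C) (x y : Hom X R), r1 ∘ x = r1 ∘ y -> r2 ∘ x = r2 ∘ y -> x = y) /\
  (exists s : Hom A R, r1 ∘ s = idm A /\ r2 ∘ s = idm A) /\
  (exists s : Hom R R, r1 ∘ s = r2 /\ r2 ∘ s = r1) /\
  (forall (P : C) (p1 p2 : Hom P R), is_pullback p1 p2 r2 r1 ->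
     exists t : Hom P R, r1 ∘ t = r1 ∘ p1 /\ r2 ∘ t = r2 ∘ p2).

Definition finitely_complete : Prop :=
  (exists T : C, is_terminal T) /\
  (forall A B : C, exists (P : C) (p1 : Hom P A) (p2 : Hom P B), is_product p1 p2) /\
  (forall (A B : C) (f g : Hom A B), exists (E : C) (e : Hom E A), is_equalizer f g e).

Definition has_coequalizers : Prop :=
  forall (A B : C) (f g : Hom A B), exists (Q : C) (q : Hom B Q), is_coequalizer f g q.

Definition is_exact : Prop :=
  finitely_complete /\
  (forall (R A B : C) (r1 r2 : Hom R A) (f : Hom A B), is_kernel_pair r1 r2 f ->
     exists (Q : C) (q : Hom A Q), is_coequalizer r1 r2 q) /\
  (forall (A B D P : C) (p1 : Hom P A) (p2 : Hom P B) (f : Hom A D) (g : Hom B D),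
     is_pullback p1 p2 f g -> is_regular_epi f -> is_regular_epi p2) /\
  (forall (R A : C) (r1 r2 : Hom R A), is_equivalence_relation r1 r2 ->
     exists (B : C) (f : Hom A B), is_kernel_pair r1 r2 f).

End Limits.

Record finite_products (C : category) := FiniteProducts {
  term : C;
  term_terminal : is_terminal term;
  prod : C -> C -> C;
  fst_ : forall A B : C, Hom (prod A B) A;
  snd_ : forall A B : C, Hom (prod A B) B;
  pair_ : forall X A B : C, Hom X A -> Hom X B -> Hom X (prod A B);
  fst_pair : forall (X A B : C) (x : Hom X A) (y : Hom X B),
    fst_ A B ∘ pair_ x y = x;
  snd_pair : forall (X A B : C) (x : Hom X A) (y : Hom X B),
    snd_ A B ∘ pair_ x y = y;
  pair_unique : forall (X A B : C) (u : Hom X (prod A B)),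
    u = pair_ (fst_ A B ∘ u) (snd_ A B ∘ u)
}.

Section Cube.
Variables (C : category) (P : finite_products C).

Definition cube (A : C) : C := prod P (prod P A A) A.

Definition triple (X A : C) (x y z : Hom X A) : Hom X (cube A) :=
  pair_ P (pair_ P x y) z.

Definition cube_map (A B : C) (f : Hom A B) : Hom (cube A) (cube B) :=
  triple (f ∘ (fst_ P A A ∘ fst_ P (prod P A A) A))
         (f ∘ (snd_ P A A ∘ fst_ P (prod P A A) A))
         (f ∘ snd_ P (prod P A A) A).

End Cube.

(* The Mal'tsev identities p(x,y,y) = x and p(x,x,y) = y are stated on
   generalized elements x, y : X -> A. *)
Record naturally_maltsev (C : category) := NaturallyMaltsev {
  nm_prod : finite_products C;
  nm_op : forall A : C, Hom (cube nm_prod A) A;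
  nm_natural : forall (A B : C) (f : Hom A B),
    f ∘ nm_op A = nm_op B ∘ cube_map nm_prod f;
  nm_op_xyy : forall (X A : C) (x y : Hom X A), nm_op A ∘ triple nm_prod x y y = x;
  nm_op_xxy : forall (X A : C) (x y : Hom X A), nm_op A ∘ triple nm_prod x x y = y
}.

(* Composition is diagrammatic: a generalized element t of [gcomp] is a pair
   (gp1 t, gp2 t) with cod (gp1 t) = dom (gp2 t).  The object of composable
   pairs is part of the data, but any two choices are canonically isomorphic.
   As [gcomp_pullback] is only an existence statement, an equation such as
   m(x, m(y, z)) = m(m(x, y), z) quantifies over the mediating arrows. *)
Record groupoid (C : category) := Groupoid {
  gob : C;
  garr : C;
  gdom : Hom garr gob;
  gcod : Hom garr gob;
  gunit : Hom gob garr;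
  gcomp : C;
  gp1 : Hom gcomp garr;
  gp2 : Hom gcomp garr;
  gmul : Hom gcomp garr;
  ginv : Hom garr garr;
  gdom_unit : gdom ∘ gunit = idm gob;
  gcod_unit : gcod ∘ gunit = idm gob;
  gcomp_pullback : is_pullback gp1 gp2 gcod gdom;
  gdom_mul : gdom ∘ gmul = gdom ∘ gp1;
  gcod_mul : gcod ∘ gmul = gcod ∘ gp2;
  gmul_unitl : forall t : Hom garr gcomp,
    gp1 ∘ t = gunit ∘ gdom -> gp2 ∘ t = idm garr -> gmul ∘ t = idm garr;
  gmul_unitr : forall t : Hom garr gcomp,
    gp1 ∘ t = idm garr -> gp2 ∘ t = gunit ∘ gcod -> gmul ∘ t = idm garr;
  gmul_assoc : forall (X : C) (xy yz xy_z x_yz : Hom X gcomp),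
    gp2 ∘ xy = gp1 ∘ yz ->
    gp1 ∘ xy_z = gmul ∘ xy -> gp2 ∘ xy_z = gp2 ∘ yz ->
    gp1 ∘ x_yz = gp1 ∘ xy -> gp2 ∘ x_yz = gmul ∘ yz ->
    gmul ∘ xy_z = gmul ∘ x_yz;
  gdom_inv : gdom ∘ ginv = gcod;
  gcod_inv : gcod ∘ ginv = gdom;
  gmul_invr : forall t : Hom garr gcomp,
    gp1 ∘ t = idm garr -> gp2 ∘ t = ginv -> gmul ∘ t = gunit ∘ gdom;
  gmul_invl : forall t : Hom garr gcomp,
    gp1 ∘ t = ginv -> gp2 ∘ t = idm garr -> gmul ∘ t = gunit ∘ gcod
}.

Section Functors.
Variable C : category.

Record gfunctor (G H : groupoid C) := GFunctor {
  fob : Hom (gob G) (gob H);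
  farr : Hom (garr G) (garr H);
  fdom : gdom H ∘ farr = fob ∘ gdom G;
  fcod : gcod H ∘ farr = fob ∘ gcod G;
  funit : farr ∘ gunit G = gunit H ∘ fob;
  fmul : forall t : Hom (gcomp G) (gcomp H),
    gp1 H ∘ t = farr ∘ gp1 G -> gp2 H ∘ t = farr ∘ gp2 G ->
    farr ∘ gmul G = gmul H ∘ t
}.

Lemma gfunctor_eq (G H : groupoid C) (F F' : gfunctor G H) :
  fob F = fob F' -> farr F = farr F' -> F = F'.
Proof.
destruct F as [f0 f1 a b c d], F' as [g0 g1 a' b' c' d']; simpl.
intros E0 E1; subst g0 g1; f_equal; apply proof_irrelevance.
Qed.

Definition gfunctor_id (G : groupoid C) : gfunctor G G.
Proof.
refine (@GFunctor G G (idm _) (idm _) _ _ _ _).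
1-3: now rewrite comp_idl, comp_idr.
intros t E1 E2; rewrite comp_idl in *.
destruct (gcomp_pullback G) as [E H].
destruct (H _ _ _ E) as [u [_ U]].
assert (u = t) as <- by now apply U.
assert (u = idm _) as -> by (apply U; rewrite !comp_idr; auto).
now rewrite comp_idr.
Defined.

Definition gfunctor_comp (G H K : groupoid C)
  (F' : gfunctor H K) (F : gfunctor G H) : gfunctor G K.
Proof.
refine (@GFunctor G K (fob F' ∘ fob F) (farr F' ∘ farr F) _ _ _ _).
- now rewrite comp_assoc, fdom, <- comp_assoc, fdom, comp_assoc.
- now rewrite comp_assoc, fcod, <- comp_assoc, fcod, comp_assoc.
- now rewrite <- comp_assoc, funit, comp_assoc, funit, comp_assoc.
- intros t E1 E2.
  destruct (gcomp_pullback G) as [EG _], (gcomp_pullback H) as [EH UH],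
    (gcomp_pullback K) as [EK UK].
  destruct (UH _ (farr F ∘ gp1 G) (farr F ∘ gp2 G)) as [u [[u1 u2] _]].
  { now rewrite !comp_assoc, fcod, fdom, <- !comp_assoc, EG. }
  destruct (UK _ (farr F' ∘ gp1 H) (farr F' ∘ gp2 H)) as [v [[v1 v2] _]].
  { now rewrite !comp_assoc, fcod, fdom, <- !comp_assoc, EH. }
  assert (t = v ∘ u) as ->.
  { destruct (UK _ (gp1 K ∘ t) (gp2 K ∘ t)) as [w [_ U]].
    { now rewrite !comp_assoc, EK. }
    transitivity w; [symmetry|]; apply U; auto.
    rewrite !comp_assoc, v1, v2, <- !comp_assoc, u1, u2, E1, E2, !comp_assoc; auto. }
  rewrite <- comp_assoc, (fmul u1 u2), !comp_assoc.
  now rewrite (fmul v1 v2).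
Defined.

Definition Grpd : category.
Proof.
refine (@Category (groupoid C) gfunctor gfunctor_id gfunctor_comp _ _ _);
  intros; apply gfunctor_eq; simpl;
  first [apply comp_idl | apply comp_idr | apply comp_assoc].
Defined.

Definition discrete_fibration (G H : Grpd) (F : Hom G H) : Prop :=
  is_pullback (farr F) (gdom G) (gdom H) (fob F) /\
  is_pullback (farr F) (gcod G) (gcod H) (fob F).

End Functors.

(* An object D of Grpd^2(C) is read with its vertical groupoids as objects of
   Grpd(C) and its horizontal structure as internal functors:
     gob D  is  (d_0, c_0 : C^1_0 => C^0_0),   garr D  is  (d_1, c_1 : C^1_1 => C^0_1),
     gdom D  is  (d^0, d^1),   gcod D  is  (c^0, c^1),   gunit D  is  (e^0, e^1).
   Likewise, for f in Grpd^2(C), fob f is (f^0_0, f^1_0) and farr f is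
   (f^0_1, f^1_1). *)
Definition Grpd2 (C : category) : category := Grpd (Grpd C).

Definition is_2groupoid (C : category) (D : Grpd2 C) : Prop :=
  is_iso (fob (gunit D)).

(* [eta] is a reflection of X in the full subcategory of objects satisfying S. *)
Definition is_reflection (D : category) (S : D -> Prop)
    (X F : D) (eta : Hom X F) : Prop :=
  S F /\
  forall (Y : D) (f : Hom X Y), S Y -> exists! g : Hom F Y, g ∘ eta = f.

(* Main.v *)
Require Import Defs.
From Stdlib Require Import ssreflect.

(** A natural Mal'tsev operation makes every hom-set an abelian heap, with
    operation written x - y + z, for which composition is affine
    ([naturally_maltsev_heap]).  This has two consequences.

    First, the multiplication of an internal groupoid is forced to be f - 1 + g
    ([gmul_hop]), every reflexive graph is a groupoid ([graph_groupoid]) and every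
    map of reflexive graphs is a functor ([graph_functor]).  The heap structure
    passes to the category of internal groupoids ([grpd_heap]), so the same
    statements apply one dimension up, and a double groupoid is merely a double
    reflexive graph.

    Second, for a split epimorphism p : A -> B with section s, the translations
    a |-> a - s x + s y identify all the fibres of p coherently.  Hence A descends
    along any regular epimorphism q : B -> B': dividing A by these translations
    over the kernel pair of q gives at once the pushout of q along s
    ([point_descent]) and a pullback square over q ([descent_pullback]).  Since the
    pushout depends on s alone, the quotient is a pullback both for the domain and
    for the codomain map of a groupoid, both being split by the unit.  So a groupoid
    V has a change of base along q which is cocartesian and whose unit is a discrete
    fibration ([groupoid_descent]).

    Take q to be the coequalizer of d^0 and c^0.  The changes of base of the two
    vertical groupoids, along q and along q d^0 = q c^0, inherit the horizontal
    structure by cocartesianness and form a 2-groupoid G.  A map from the double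
    groupoid to a 2-groupoid identifies d^0 and c^0 on objects, hence factors
    through q there, and then through G ([discrete_fibration_to_2groupoid]).  This
    already determines the reflection up to a retraction, which suffices to carry
    the pullback squares over. *)

Set Implicit Arguments.
Unset Strict Implicit.
Unset Printing Implicit Defensive.

(** * Universal properties and regular epimorphisms *)

Section Universal.
Variable E : category.

Definition has_pullbacks : Prop :=
  forall (A B D : E) (f : Hom A D) (g : Hom B D),
    exists (P : E) (p1 : Hom P A) (p2 : Hom P B), is_pullback p1 p2 f g.

Definition is_epi (A B : E) (f : Hom A B) : Prop :=
  forall (X : E) (u v : Hom B X), u ∘ f = v ∘ f -> u = v.

(** Composites are kept in right-associated form; this lets an equation between
    composites be used at the head of a longer one. *)
Lemma comp_head (A B D : E) (f : Hom B D) (g : Hom A B) (h : Hom A D) :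
  f ∘ g = h -> forall (X : E) (u : Hom X A), f ∘ (g ∘ u) = h ∘ u.
Proof. by move=> e X u; rewrite comp_assoc e. Qed.

Lemma pullback_lift (A B D P X : E) (p1 : Hom P A) (p2 : Hom P B)
    (f : Hom A D) (g : Hom B D) (x1 : Hom X A) (x2 : Hom X B) :
  is_pullback p1 p2 f g -> f ∘ x1 = g ∘ x2 ->
  exists u : Hom X P, p1 ∘ u = x1 /\ p2 ∘ u = x2.
Proof. by case=> _ U e; case: (U _ _ _ e) => u [? _]; exists u. Qed.

Lemma pullback_ext (A B D P X : E) (p1 : Hom P A) (p2 : Hom P B)
    (f : Hom A D) (g : Hom B D) (u v : Hom X P) :
  is_pullback p1 p2 f g -> p1 ∘ u = p1 ∘ v -> p2 ∘ u = p2 ∘ v -> u = v.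
Proof.
case=> e U e1 e2.
have e' : f ∘ (p1 ∘ u) = g ∘ (p2 ∘ u) by rewrite !comp_assoc e.
case: (U _ _ _ e') => w [_ W].
by rewrite -(W u) // -(W v).
Qed.

Lemma pullback_intro (A B D P : E) (p1 : Hom P A) (p2 : Hom P B)
    (f : Hom A D) (g : Hom B D) :
  f ∘ p1 = g ∘ p2 ->
  (forall (X : E) (u v : Hom X P),
     p1 ∘ u = p1 ∘ v -> p2 ∘ u = p2 ∘ v -> u = v) ->
  (forall (X : E) (x1 : Hom X A) (x2 : Hom X B), f ∘ x1 = g ∘ x2 ->
     exists u : Hom X P, p1 ∘ u = x1 /\ p2 ∘ u = x2) ->
  is_pullback p1 p2 f g.
Proof.
move=> e M L; split=> // X x1 x2 ex.
case: (L _ _ _ ex) => u [u1 u2]; exists u; split=> // v [v1 v2].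
by apply: M; rewrite ?u1 ?u2 ?v1 ?v2.
Qed.

Lemma coequalizer_epi (A B Q : E) (f g : Hom A B) (q : Hom B Q) :
  is_coequalizer f g q -> is_epi q.
Proof.
case=> e U X u v uv.
have e' : (u ∘ q) ∘ f = (u ∘ q) ∘ g by rewrite -!comp_assoc e.
case: (U _ _ e') => w [_ W].
by rewrite -(W u) // -(W v).
Qed.

Lemma coequalizer_desc (A B Q X : E) (f g : Hom A B) (q : Hom B Q) (x : Hom B X) :
  is_coequalizer f g q -> x ∘ f = x ∘ g -> exists u : Hom Q X, u ∘ q = x.
Proof. by case=> _ U e; case: (U _ _ e) => u [? _]; exists u. Qed.

Lemma coequalizer_intro (A B Q : E) (f g : Hom A B) (q : Hom B Q) :
  q ∘ f = q ∘ g -> is_epi q ->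
  (forall (X : E) (x : Hom B X), x ∘ f = x ∘ g -> exists u : Hom Q X, u ∘ q = x) ->
  is_coequalizer f g q.
Proof.
move=> e M D; split=> // X x ex.
case: (D _ _ ex) => u <-; exists u; split=> // v vu.
by apply: M.
Qed.

Lemma regular_epi_epi (A B : E) (f : Hom A B) : is_regular_epi f -> is_epi f.
Proof. by case=> R [r1 [r2 /coequalizer_epi]]. Qed.

Lemma regular_epi_kernel_pair (R A B : E) (r1 r2 : Hom R A) (f : Hom A B) :
  is_regular_epi f -> is_kernel_pair r1 r2 f -> is_coequalizer r1 r2 f.
Proof.
move=> rf K; case: (rf) => S [s1 [s2 cf]].
apply: coequalizer_intro; [by case: K | exact: regular_epi_epi | move=> X x ex].
apply: (coequalizer_desc cf).
case: (pullback_lift K (proj1 cf)) => t [<- <-].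
by rewrite !comp_assoc ex.
Qed.

(** If x identifies the kernel pair of q d, then x = x e d, because (1, e d) lies in
    that kernel pair; and x e factors through q. *)
Lemma regular_epi_comp_split (A B Q : E) (q : Hom B Q) (d : Hom A B) (e : Hom B A) :
  has_pullbacks -> is_regular_epi q -> d ∘ e = idm B -> is_regular_epi (q ∘ d).
Proof.
move=> pb rq de; have qepi := regular_epi_epi rq.
case: rq => S [s1 [s2 cq]].
case: (pb _ _ _ (q ∘ d) (q ∘ d)) => R [r1 [r2 K]].
exists R, r1, r2; apply: coequalizer_intro; first by case: K.
- move=> X u v uv; apply: qepi.
  rewrite -[q]comp_idr -de !comp_assoc -[u ∘ q ∘ d]comp_assoc uv.
  by rewrite !comp_assoc.
- move=> X x ex.
  have kx : forall (Y : E) (a b : Hom Y A), q ∘ d ∘ a = q ∘ d ∘ b -> x ∘ a = x ∘ b.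
  { by move=> Y a b /(pullback_lift K) [t [<- <-]]; rewrite !comp_assoc ex. }
  have xed : x ∘ (e ∘ d) = x.
  { rewrite -[RHS]comp_idr; apply: kx.
    by rewrite comp_idr -!comp_assoc (comp_head de) comp_idl. }
  have [u ux] : exists u : Hom Q X, u ∘ q = x ∘ e.
  { apply: (coequalizer_desc cq); rewrite -!comp_assoc; apply: kx.
    by rewrite -!comp_assoc !(comp_head de) !comp_idl (proj1 cq). }
  by exists u; rewrite comp_assoc ux -comp_assoc.
Qed.

End Universal.

Lemma finitely_complete_pullbacks (C : category) :
  finitely_complete C -> has_pullbacks C.
Proof.
case=> _ [prods eqs] A B D f g.
case: (prods A B) => Q [p1 [p2 HQ]].
case: (eqs _ _ (f ∘ p1) (g ∘ p2)) => P [k [ek uk]].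
exists P, (p1 ∘ k), (p2 ∘ k); split; first by rewrite !comp_assoc.
move=> X x1 x2 ex.
case: (HQ _ x1 x2) => v [[v1 v2] vu].
have ev : f ∘ p1 ∘ v = g ∘ p2 ∘ v by rewrite -!comp_assoc v1 v2.
case: (uk _ _ ev) => u [eu uu].
exists u; split; first by rewrite -!comp_assoc eu.
move=> w [w1 w2]; apply: uu; symmetry; apply: vu.
by rewrite !comp_assoc.
Qed.

(** * Categories enriched in abelian heaps *)

(** [hop x y z] plays the role of x - y + z, so that each hom-set is a possibly
    empty torsor under an abelian group and composition is affine in both
    variables.  This is the part of a natural Mal'tsev operation that does not
    mention products, and in this form it passes to internal groupoids by acting
    on objects and on arrows separately. *)
Record heap_enrichment (E : category) := HeapEnrichment {
  hop : forall X A : E, Hom X A -> Hom X A -> Hom X A -> Hom X A;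
  hop_post : forall (X A B : E) (f : Hom A B) (x y z : Hom X A),
    f ∘ hop x y z = hop (f ∘ x) (f ∘ y) (f ∘ z);
  hop_pre : forall (Y X A : E) (u : Hom Y X) (x y z : Hom X A),
    hop x y z ∘ u = hop (x ∘ u) (y ∘ u) (z ∘ u);
  hop_xyy : forall (X A : E) (x y : Hom X A), hop x y y = x;
  hop_xxy : forall (X A : E) (x y : Hom X A), hop x x y = y;
  hop_assoc : forall (X A : E) (x y z t w : Hom X A),
    hop x y (hop z t w) = hop (hop x y z) t w;
  hop_comm : forall (X A : E) (x y z : Hom X A), hop x y z = hop z y x
}.

(** Naturality of the Mal'tsev operation at its own components says that it
    commutes with itself; by an Eckmann-Hilton argument this gives associativity
    and commutativity. *)
Lemma naturally_maltsev_heap (C : category) :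
  naturally_maltsev C -> heap_enrichment C.
Proof.
case=> P op nat xyy xxy.
have pair_comp : forall (Y X A B : C) (x : Hom X A) (y : Hom X B) (u : Hom Y X),
    pair_ P x y ∘ u = pair_ P (x ∘ u) (y ∘ u).
{ by move=> *; rewrite [LHS]pair_unique !comp_assoc fst_pair snd_pair. }
pose mu (X A : C) (x y z : Hom X A) := op A ∘ triple P x y z.
have post : forall (X A B : C) (f : Hom A B) (x y z : Hom X A),
    f ∘ mu _ _ x y z = mu _ _ (f ∘ x) (f ∘ y) (f ∘ z).
{ move=> X A B f x y z; rewrite /mu comp_assoc nat -comp_assoc; congr (_ ∘ _).
  by rewrite /cube_map /triple !pair_comp -!comp_assoc
    !(fst_pair, comp_head (fst_pair _ _ _), snd_pair). }
have pre : forall (Y X A : C) (u : Hom Y X) (x y z : Hom X A),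
    mu _ _ x y z ∘ u = mu _ _ (x ∘ u) (y ∘ u) (z ∘ u).
{ by move=> *; rewrite /mu -comp_assoc /triple !pair_comp. }
have self : forall (X A : C) (a b c a' b' c' a2 b2 c2 : Hom X A),
    mu _ _ (mu _ _ a b c) (mu _ _ a' b' c') (mu _ _ a2 b2 c2) =
    mu _ _ (mu _ _ a a' a2) (mu _ _ b b' b2) (mu _ _ c c' c2).
{ move=> X A a b c a' b' c' a2 b2 c2.
  rewrite {2 3 4}/mu -post {2}/mu; congr (_ ∘ _).
  rewrite [LHS]pair_unique [fst_ P _ _ ∘ _]pair_unique !post /triple.
  by rewrite !(fst_pair, snd_pair). }
have {}xyy : forall (X A : C) (x y : Hom X A), mu _ _ x y y = x by [].
have {}xxy : forall (X A : C) (x y : Hom X A), mu _ _ x x y = y by [].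
clearbody mu.
have assoc : forall (X A : C) (x y z t w : Hom X A),
    mu _ _ x y (mu _ _ z t w) = mu _ _ (mu _ _ x y z) t w.
{ move=> X A x y z t w.
  by have := self _ _ x t t y t t z t w; rewrite !xyy xxy. }
have comm : forall (X A : C) (x y z : Hom X A), mu _ _ x y z = mu _ _ z y x.
{ move=> X A x y z.
  by have := self _ _ y y x y y y z y y; rewrite !xyy !xxy. }
exact: (@HeapEnrichment C mu).
Qed.

Section Heap.
Variables (E : category) (H : heap_enrichment E).

Lemma hop_cancel (X A : E) (x y z : Hom X A) : hop H x y z = x -> y = z.
Proof.
by move=> e; have := hop_assoc H y x x y z; rewrite e !hop_xyy hop_xxy.
Qed.

(** * Reflexive graphs as groupoids *)

(** The base is a parameter so that two graphs can have the same object of vertices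
    definitionally.  The object of composable pairs is part of the data because the
    existence of pullbacks is a mere proposition. *)
Record graph_over (B : E) := GraphOver {
  arr : E;
  src : Hom arr B;
  tgt : Hom arr B;
  idn : Hom B arr;
  src_idn : src ∘ idn = idm B;
  tgt_idn : tgt ∘ idn = idm B;
  pairs : E;
  pfst : Hom pairs arr;
  psnd : Hom pairs arr;
  pairs_pullback : is_pullback pfst psnd tgt src
}.

(** The composite of f and g is f - 1 + g, and the inverse of f is 1 - f + 1, where
    each 1 is the identity at the appropriate end of f. *)
Definition graph_groupoid (B : E) (G : graph_over B) : Grpd E.
Proof.
refine (@Groupoid E B (arr G) (src G) (tgt G) (idn G) (pairs G) (pfst G) (psnd G)
  (hop H (pfst G) (idn G ∘ (tgt G ∘ pfst G)) (psnd G))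
  (hop H (idn G ∘ src G) (idm (arr G)) (idn G ∘ tgt G))
  (src_idn G) (tgt_idn G) (pairs_pullback G) _ _ _ _ _ _ _ _ _);
  have hopE := (hop_post H, hop_pre H);
  have e := proj1 (pairs_pullback G);
  have s1' := comp_head (src_idn G);
  have t1' := comp_head (tgt_idn G).
- by rewrite hopE s1' comp_idl e hop_xyy.
- by rewrite hopE t1' comp_idl hop_xxy.
- by move=> t a b; rewrite hopE -!comp_assoc a b t1' comp_idl hop_xxy.
- by move=> t a b; rewrite hopE -!comp_assoc a b comp_idr hop_xyy.
- move=> X xy yz xy_z x_yz a b c d f.
  rewrite !hopE -!comp_assoc in b f *.
  by rewrite b c d f !hopE !t1' !comp_idl hop_xxy a hop_assoc.
- by rewrite hopE !(s1', comp_idl, comp_idr) hop_xxy.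
- by rewrite hopE !(t1', comp_idl, comp_idr) hop_xyy.
- move=> t a b; rewrite hopE -!comp_assoc a b comp_idr.
  by rewrite [hop H _ (idm _) _]hop_comm hop_assoc hop_xyy hop_xxy.
- move=> t a b; rewrite hopE -!comp_assoc a b !hopE.
  rewrite !(t1', comp_idl, comp_idr) hop_xyy.
  by rewrite [hop H _ (idm _) _]hop_comm -hop_assoc hop_xxy hop_xyy.
Defined.

(** A composable pair (f, g) is the alternating combination of (f, 1), (1, 1) and
    (1, g), and any multiplication, being a morphism, preserves this combination;
    so a reflexive graph carries at most one groupoid structure. *)
Lemma gmul_hop (G : groupoid E) :
  gmul G = hop H (gp1 G) (gunit G ∘ (gcod G ∘ gp1 G)) (gp2 G).
Proof.
have pb := gcomp_pullback G.
have s1 := gdom_unit G; have t1 := gcod_unit G.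
case: (pullback_lift (x1 := idm (garr G)) (x2 := gunit G ∘ gcod G) pb).
{ by rewrite comp_idr (comp_head s1) comp_idl. }
move=> r [r1 r2].
case: (pullback_lift (x1 := gunit G ∘ gdom G) (x2 := idm (garr G)) pb).
{ by rewrite comp_idr (comp_head t1) comp_idl. }
move=> l [l1 l2].
have split_pair : idm (gcomp G) =
    hop H (r ∘ gp1 G) (r ∘ (gunit G ∘ (gcod G ∘ gp1 G))) (l ∘ gp2 G).
{ apply: (pullback_ext pb); rewrite hop_post comp_idr.
  - rewrite !(comp_head r1) !(comp_head l1) -!comp_assoc !comp_idl (proj1 pb).
    by rewrite hop_xyy.
  - rewrite !(comp_head r2) !(comp_head l2) -!comp_assoc !comp_idl.
    by rewrite (comp_head t1) comp_idl hop_xxy. }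
rewrite -[LHS]comp_idr split_pair hop_post.
by rewrite !(comp_head (gmul_unitr r1 r2)) (comp_head (gmul_unitl l1 l2)) !comp_idl.
Qed.

Lemma graph_map_fmul (G K : groupoid E) (f0 : Hom (gob G) (gob K))
    (f1 : Hom (garr G) (garr K)) :
  gcod K ∘ f1 = f0 ∘ gcod G -> f1 ∘ gunit G = gunit K ∘ f0 ->
  forall t : Hom (gcomp G) (gcomp K),
    gp1 K ∘ t = f1 ∘ gp1 G -> gp2 K ∘ t = f1 ∘ gp2 G -> f1 ∘ gmul G = gmul K ∘ t.
Proof.
move=> ec eu t e1 e2.
rewrite !gmul_hop hop_post hop_pre -!comp_assoc e1 e2 (comp_head ec) (comp_head eu).
by rewrite -!comp_assoc.
Qed.

Definition graph_functor (G K : Grpd E) (f0 : Hom (gob G) (gob K))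
    (f1 : Hom (garr G) (garr K)) (ed : gdom K ∘ f1 = f0 ∘ gdom G)
    (ec : gcod K ∘ f1 = f0 ∘ gcod G) (eu : f1 ∘ gunit G = gunit K ∘ f0) :
  Hom G K :=
  GFunctor ed ec eu (graph_map_fmul ec eu).

Definition hop_functor (G K : Grpd E) (f g h : Hom G K) : Hom G K.
Proof.
apply: (@graph_functor G K (hop H (fob f) (fob g) (fob h))
                           (hop H (farr f) (farr g) (farr h))).
- by rewrite hop_post hop_pre !fdom.
- by rewrite hop_post hop_pre !fcod.
- by rewrite hop_post hop_pre !funit.
Defined.

Definition grpd_heap : heap_enrichment (Grpd E).
Proof.
refine (@HeapEnrichment (Grpd E) hop_functor _ _ _ _ _ _);
  intros; apply: gfunctor_eq;
  by rewrite /= ?(hop_post, hop_pre, hop_xyy, hop_xxy, hop_assoc) // hop_comm.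
Defined.

Lemma grpd_pullbacks : has_pullbacks E -> has_pullbacks (Grpd E).
Proof.
move=> pb A B T f g.
case: (pb _ _ _ (fob f) (fob g)) => P0 [a0 [b0 pb0]].
case: (pb _ _ _ (farr f) (farr g)) => P1 [a1 [b1 pb1]].
case: (pullback_lift (x1 := gdom A ∘ a1) (x2 := gdom B ∘ b1) pb0).
{ by rewrite !comp_assoc -!fdom -!comp_assoc (proj1 pb1). }
move=> s [sa sb].
case: (pullback_lift (x1 := gcod A ∘ a1) (x2 := gcod B ∘ b1) pb0).
{ by rewrite !comp_assoc -!fcod -!comp_assoc (proj1 pb1). }
move=> t [ta tb].
case: (pullback_lift (x1 := gunit A ∘ a0) (x2 := gunit B ∘ b0) pb1).
{ by rewrite !comp_assoc !funit -!comp_assoc (proj1 pb0). }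
move=> e [ea eb].
have se : s ∘ e = idm P0.
{ apply: (pullback_ext pb0); rewrite comp_idr.
  - by rewrite (comp_head sa) -comp_assoc ea (comp_head (gdom_unit A)) comp_idl.
  - by rewrite (comp_head sb) -comp_assoc eb (comp_head (gdom_unit B)) comp_idl. }
have te : t ∘ e = idm P0.
{ apply: (pullback_ext pb0); rewrite comp_idr.
  - by rewrite (comp_head ta) -comp_assoc ea (comp_head (gcod_unit A)) comp_idl.
  - by rewrite (comp_head tb) -comp_assoc eb (comp_head (gcod_unit B)) comp_idl. }
case: (pb _ _ _ t s) => Q [q1 [q2 pbq]].
pose P := graph_groupoid (GraphOver se te pbq).
pose a := @graph_functor P A a0 a1 (eq_sym sa) (eq_sym ta) ea.
pose b := @graph_functor P B b0 b1 (eq_sym sb) (eq_sym tb) eb.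
exists P, a, b; apply: pullback_intro.
- by apply: gfunctor_eq; [case: pb0 | case: pb1].
- move=> X u v e1 e2; apply: gfunctor_eq.
  + by apply: (pullback_ext pb0); [have := f_equal (@fob _ _ _) e1
                                  | have := f_equal (@fob _ _ _) e2].
  + by apply: (pullback_ext pb1); [have := f_equal (@farr _ _ _) e1
                                  | have := f_equal (@farr _ _ _) e2].
- move=> X x y exy.
  case: (pullback_lift pb0 (f_equal (@fob _ _ _) exy)) => u0 [ua0 ub0].
  case: (pullback_lift pb1 (f_equal (@farr _ _ _) exy)) => u1 [ua1 ub1].
  have ed : gdom P ∘ u1 = u0 ∘ gdom X.
  { apply: (pullback_ext pb0) => /=.
    - by rewrite (comp_head sa) -comp_assoc ua1 fdom (comp_head ua0).
    - by rewrite (comp_head sb) -comp_assoc ub1 fdom (comp_head ub0). }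
  have ec : gcod P ∘ u1 = u0 ∘ gcod X.
  { apply: (pullback_ext pb0) => /=.
    - by rewrite (comp_head ta) -comp_assoc ua1 fcod (comp_head ua0).
    - by rewrite (comp_head tb) -comp_assoc ub1 fcod (comp_head ub0). }
  have eu : u1 ∘ gunit X = gunit P ∘ u0.
  { apply: (pullback_ext pb1) => /=.
    - by rewrite (comp_head ua1) funit (comp_head ea) -comp_assoc ua0.
    - by rewrite (comp_head ub1) funit (comp_head eb) -comp_assoc ub0. }
  by exists (graph_functor ed ec eu); split; apply: gfunctor_eq.
Qed.

End Heap.

(** * Descent of split epimorphisms along regular epimorphisms *)

Section Descent.
Variables (C : category) (exactC : is_exact C) (H : heap_enrichment C).

(** Write A_x for the fibre of p over x.  The map a |-> a - s x + s y identifies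
    A_x with A_y, and these identifications compose, so over the kernel pair of q
    they form an equivalence relation on A, which is effective by exactness.  Its
    quotient is the pushout of q along s.  The description of the kernel pair of
    [eta] is symmetric in all retractions of s, which is why it is stated without
    reference to p. *)
Lemma point_descent (A B B' : C) (p : Hom A B) (s : Hom B A) (q : Hom B B') :
  p ∘ s = idm B -> is_regular_epi q ->
  exists (A' : C) (s' : Hom B' A') (eta : Hom A A'),
    s' ∘ q = eta ∘ s /\
    is_regular_epi eta /\
    (forall (X : C) (u v : Hom X A), eta ∘ u = eta ∘ v ->
       exists x y : Hom X B, v = hop H u (s ∘ x) (s ∘ y)) /\
    (forall (X : C) (x : Hom A X) (y : Hom B' X), x ∘ s = y ∘ q ->
       exists f : Hom A' X, f ∘ eta = x /\ f ∘ s' = y).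
Proof.
move=> ps rq.
case: exactC => fc [kc [_ eff]].
have pb := finitely_complete_pullbacks fc.
case: (pb _ _ _ q q) => R [r1 [r2 kq]].
case: (pb _ _ _ p r1) => S [a [r pS]].
have cq := regular_epi_kernel_pair rq kq.
have qepi := regular_epi_epi rq.
have [pa _] := pS.
have ps' := comp_head ps.
have [a2 [a2E pa2]] : exists a2 : Hom S A,
    a2 = hop H a (s ∘ (p ∘ a)) (s ∘ (p ∘ a2)) /\ p ∘ a2 = r2 ∘ r.
{ exists (hop H a (s ∘ (r1 ∘ r)) (s ∘ (r2 ∘ r))).
  by rewrite hop_post !ps' !comp_idl pa hop_xxy. }
have a2u : forall (X : C) (u : Hom X S),
    a2 ∘ u = hop H (a ∘ u) (s ∘ (p ∘ (a ∘ u))) (s ∘ (p ∘ (a2 ∘ u))).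
{ by move=> X u; rewrite {1}a2E hop_pre -!comp_assoc. }
have lift : forall (X : C) (u : Hom X A) (y : Hom X B), q ∘ (p ∘ u) = q ∘ y ->
    exists w : Hom X S, a ∘ w = u /\ a2 ∘ w = hop H u (s ∘ (p ∘ u)) (s ∘ y).
{ move=> X u y /(pullback_lift kq) [v [v1 v2]].
  case: (pullback_lift pS (eq_sym v1)) => w [w1 w2]; exists w; split=> //.
  by rewrite a2u w1 (comp_head pa2) -comp_assoc w2 v2. }
have qS : forall (X : C) (u : Hom X S), q ∘ (p ∘ (a ∘ u)) = q ∘ (p ∘ (a2 ∘ u)).
{ move=> X u; rewrite (comp_head pa2) (comp_head pa) -!comp_assoc.
  by rewrite (comp_head (proj1 kq)) -comp_assoc. }
have eqS : is_equivalence_relation a a2.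
{ split; [|split; [|split]].
  - move=> X x y e1 e2; apply: (pullback_ext pS) => //; apply: (pullback_ext kq).
    + by rewrite !(comp_head (eq_sym pa)) -!comp_assoc e1.
    + by rewrite !(comp_head (eq_sym pa2)) -!comp_assoc e2.
  - case: (lift A (idm A) p) => [|w [w1 w2]]; first by rewrite comp_idr.
    by exists w; rewrite w1 w2 comp_idr hop_xyy.
  - case: (lift S a2 (p ∘ a)) => [|w [w1 w2]].
    { by have := qS _ (idm S); rewrite !comp_idr. }
    exists w; split=> //; rewrite w2 {1}a2E.
    by rewrite -hop_assoc hop_xxy hop_xyy.
  - move=> P p1 p2 [ep _].
    case: (lift P (a ∘ p1) (p ∘ (a2 ∘ p2))) => [|w [w1 w2]].
    { by rewrite qS ep qS. }
    exists w; split=> //.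
    by rewrite w2 [RHS]a2u -ep {1}[a2 ∘ p1]a2u -hop_assoc hop_xxy. }
case: (eff _ _ _ _ eqS) => Z [f kf].
case: (kc _ _ _ _ _ _ kf) => A' [eta ceta].
have [m mE] := coequalizer_desc ceta (proj1 kf).
have etaS : forall (X : C) (u : Hom X S), eta ∘ (a ∘ u) = eta ∘ (a2 ∘ u).
{ by move=> X u; rewrite !comp_assoc (proj1 ceta). }
have [s' s'E] : exists s' : Hom B' A', s' ∘ q = eta ∘ s.
{ apply: (coequalizer_desc cq); rewrite -!comp_assoc.
  case: (lift R (s ∘ r1) r2) => [|w [w1 w2]].
  { by rewrite ps' comp_idl (proj1 kq). }
  by rewrite -w1 etaS w2 ps' comp_idl hop_xxy. }
exists A', s', eta; split=> //; split; first by exists S, a, a2.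
split.
- move=> X u v e.
  have /(pullback_lift kf) [w [<- <-]] : f ∘ u = f ∘ v by rewrite -mE -!comp_assoc e.
  by rewrite a2u; exists (p ∘ (a ∘ w)), (p ∘ (a2 ∘ w)).
- move=> X x y e.
  have [g gE] : exists g : Hom A' X, g ∘ eta = x.
  { apply: (coequalizer_desc ceta).
    rewrite a2E hop_post !(comp_head e) -!comp_assoc.
    by have := qS _ (idm S); rewrite !comp_idr => ->; rewrite hop_xyy. }
  exists g; split=> //; apply: qepi.
  by rewrite -comp_assoc s'E comp_assoc gE.
Qed.

(** Barr-Kock: the comparison with the pullback is injective because a difference
    s y - s x killed by p vanishes, and it is surjective because a local solution
    can be translated along s into the prescribed fibre; injectivity then makes the
    local solutions glue. *)
Lemma descent_pullback (A B A' B' : C) (p : Hom A B) (s : Hom B A) (q : Hom B B')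
    (eta : Hom A A') (s' : Hom B' A') (p' : Hom A' B') :
  p ∘ s = idm B -> s' ∘ q = eta ∘ s -> p' ∘ eta = q ∘ p -> is_regular_epi eta ->
  (forall (X : C) (u v : Hom X A), eta ∘ u = eta ∘ v ->
     exists x y : Hom X B, v = hop H u (s ∘ x) (s ∘ y)) ->
  is_pullback eta p p' q.
Proof.
move=> ps es ep reta K.
case: exactC => fc [_ [stable _]].
have pb := finitely_complete_pullbacks fc.
have ps' := comp_head ps.
have ext : forall (X : C) (u v : Hom X A),
    eta ∘ u = eta ∘ v -> p ∘ u = p ∘ v -> u = v.
{ move=> X u v /K [x [y ->]].
  rewrite hop_post !ps' !comp_idl => e.
  by rewrite (hop_cancel (eq_sym e)) hop_xyy. }
apply: pullback_intro => // X x1 x2 ex.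
case: (pb _ _ _ eta x1) => Y [y [t pY]].
have rt : is_regular_epi t := stable _ _ _ _ _ _ _ _ pY reta.
case: (pb _ _ _ t t) => T [k1 [k2 kt]].
pose w := hop H y (s ∘ (p ∘ y)) (s ∘ (x2 ∘ t)).
have pw : p ∘ w = x2 ∘ t by rewrite hop_post !ps' !comp_idl hop_xxy.
have etaw : eta ∘ w = x1 ∘ t.
{ rewrite hop_post !(comp_head (eq_sym es)) -!comp_assoc.
  rewrite (comp_head (eq_sym ep)) (comp_head (eq_sym ex)) -!comp_assoc.
  by rewrite (proj1 pY) hop_xyy. }
have [u uE] : exists u : Hom X A, u ∘ t = w.
{ apply: (coequalizer_desc (regular_epi_kernel_pair rt kt)); apply: ext.
  - by rewrite !(comp_head etaw) -!comp_assoc (proj1 kt).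
  - by rewrite !(comp_head pw) -!comp_assoc (proj1 kt). }
exists u; split; apply: (regular_epi_epi rt); by rewrite -comp_assoc uE.
Qed.

(** The change of base of a groupoid along a regular epimorphism of its objects:
    a discrete fibration that is cocartesian over q. *)
Lemma groupoid_descent (V : Grpd C) (B' : C) (q : Hom (gob V) B') :
  is_regular_epi q ->
  exists (V' : graph_over B') (h : Hom V (graph_groupoid H V')),
    fob h = q /\
    is_epi (farr h) /\
    discrete_fibration h /\
    (forall (W : Grpd C) (f : Hom V W) (y : Hom B' (gob W)),
       fob f = y ∘ q ->
       exists g : Hom (graph_groupoid H V') W, fob g = y /\ g ∘ h = f).
Proof.
move=> rq.
have qepi := regular_epi_epi rq.
have pb := finitely_complete_pullbacks (proj1 exactC).
have du := gdom_unit V; have cu := gcod_unit V.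
case: (point_descent du rq) => A' [e [eta [eE [reta [K po]]]]].
have aepi := regular_epi_epi reta.
have [d [dE de]] : exists d : Hom A' B', d ∘ eta = q ∘ gdom V /\ d ∘ e = idm B'.
{ by apply: po; rewrite -comp_assoc du comp_idl comp_idr. }
have [c [cE ce]] : exists c : Hom A' B', c ∘ eta = q ∘ gcod V /\ c ∘ e = idm B'.
{ by apply: po; rewrite -comp_assoc cu comp_idl comp_idr. }
case: (pb _ _ _ c d) => Q [q1 [q2 pbq]].
pose V' := GraphOver de ce pbq.
exists V', (@graph_functor C H V (graph_groupoid H V') q eta dE cE (eq_sym eE)).
split=> //; split=> //; split.
{ by split; [apply: (descent_pullback du) | apply: (descent_pullback cu)]; eauto. }
move=> W f y fy.
have [g [gE ge]] : exists g : Hom A' (garr W),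
    g ∘ eta = farr f /\ g ∘ e = gunit W ∘ y.
{ by apply: po; rewrite funit fy comp_assoc. }
have gd : gdom W ∘ g = y ∘ d.
{ by apply: aepi; rewrite -!comp_assoc gE dE fdom fy comp_assoc. }
have gc : gcod W ∘ g = y ∘ c.
{ by apply: aepi; rewrite -!comp_assoc gE cE fcod fy comp_assoc. }
exists (@graph_functor C H (graph_groupoid H V') W y g gd gc ge).
by split=> //; apply: gfunctor_eq.
Qed.

End Descent.

(** * Discrete fibrations under a split monomorphism of codomains *)

Section SplitMono.
Variable C : category.

Lemma grpd_epi (G K : Grpd C) (h : Hom G K) :
  is_epi (fob h) -> is_epi (farr h) -> is_epi h.
Proof.
move=> e0 e1 X u v uv; apply: gfunctor_eq.
- exact: (e0 _ _ _ (f_equal (@fob _ _ _) uv)).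
- exact: (e1 _ _ _ (f_equal (@farr _ _ _) uv)).
Qed.

Lemma pullback_of_comp_mono (A B D P A' D' : C) (p1 : Hom P A) (p2 : Hom P B)
    (f : Hom A D) (g : Hom B D) (f' : Hom A' D')
    (k1 : Hom A A') (k0 : Hom D D') (j1 : Hom A' A) :
  j1 ∘ k1 = idm A -> f' ∘ k1 = k0 ∘ f -> f ∘ p1 = g ∘ p2 ->
  is_pullback (k1 ∘ p1) p2 f' (k0 ∘ g) -> is_pullback p1 p2 f g.
Proof.
move=> jk fk sq pb; apply: pullback_intro => //.
- by move=> X u v e1 e2; apply: (pullback_ext pb) => //; rewrite -!comp_assoc e1.
- move=> X x1 x2 ex.
  case: (pullback_lift (x1 := k1 ∘ x1) (x2 := x2) pb).
  { by rewrite (comp_head fk) -!comp_assoc ex. }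
  move=> u [u1 u2]; exists u; split=> //.
  rewrite -[LHS]comp_idl -[RHS]comp_idl -jk -!comp_assoc.
  by rewrite -u1 -comp_assoc.
Qed.

Lemma discrete_fibration_of_comp (G K L : Grpd C) (h : Hom G K) (k : Hom K L)
    (j : Hom L K) :
  j ∘ k = idm K -> discrete_fibration (k ∘ h) -> discrete_fibration h.
Proof.
move=> /(f_equal (@farr _ _ _)) jk [pd pc]; split.
- exact: (pullback_of_comp_mono jk (fdom k) (fdom h) pd).
- exact: (pullback_of_comp_mono jk (fcod k) (fcod h) pc).
Qed.

End SplitMono.

(** * The reflection *)

(** The groupoids of the reflection are the changes of base of the two vertical
    groupoids along q and q d^0, where q is the coequalizer of d^0 and c^0. *)
Lemma discrete_fibration_to_2groupoid (C : category) (H : heap_enrichment C)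
    (exactC : is_exact C) (coeqC : has_coequalizers C) (D : Grpd2 C) :
  exists (G : Grpd2 C) (eta : Hom D G),
    is_2groupoid G /\
    discrete_fibration (fob eta) /\ discrete_fibration (farr eta) /\
    (forall (Y : Grpd2 C) (f : Hom D Y), is_2groupoid Y ->
       exists g : Hom G Y, g ∘ eta = f).
Proof.
have pb := finitely_complete_pullbacks (proj1 exactC).
have pb2 := grpd_pullbacks H pb.
have du := gdom_unit D; have cu := gcod_unit D.
have du0 : fob (gdom D) ∘ fob (gunit D) = idm (gob (gob D)).
{ exact: (f_equal (@fob _ _ _) du). }
case: (coeqC _ _ (fob (gdom D)) (fob (gcod D))) => B [q cq].
have rq : is_regular_epi q by exists (gob (garr D)), (fob (gdom D)), (fob (gcod D)).
have rq1 : is_regular_epi (q ∘ fob (gdom D)).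
{ exact: (regular_epi_comp_split pb rq du0). }
have qepi := regular_epi_epi rq; have q1epi := regular_epi_epi rq1.
case: (groupoid_descent exactC H rq) => V0 [h0 [h0q [e0 [df0 co0]]]].
case: (groupoid_descent exactC H rq1) => V1 [h1 [h1q [e1 [df1 co1]]]].
have h0epi : is_epi h0 by apply: grpd_epi; rewrite ?h0q.
have h1epi : is_epi h1 by apply: grpd_epi; rewrite ?h1q.
case: (co1 _ (h0 ∘ gdom D) (idm B)) => [|d [d0 dE]].
{ by rewrite /= h0q comp_idl. }
case: (co1 _ (h0 ∘ gcod D) (idm B)) => [|c [c0 cE]].
{ by rewrite /= h0q comp_idl (proj1 cq). }
case: (co0 _ (h1 ∘ gunit D) (idm B)) => [|e [ee eE]].
{ by rewrite /= h1q comp_idl -comp_assoc du0 comp_idr. }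
have de : d ∘ e = idm _.
{ apply: h0epi; rewrite -comp_assoc eE.
  rewrite (comp_head dE).
  by rewrite -comp_assoc du comp_idr comp_idl. }
have ce : c ∘ e = idm _.
{ apply: h0epi; rewrite -comp_assoc eE.
  rewrite (comp_head cE).
  by rewrite -comp_assoc cu comp_idr comp_idl. }
case: (pb2 _ _ _ c d) => Q [q1 [q2 pbq]].
pose G0 := GraphOver de ce pbq.
pose G := graph_groupoid (grpd_heap H) G0.
pose eta := @graph_functor _ (grpd_heap H) D G h0 h1 dE cE (eq_sym eE).
exists G, eta.
split; first by exists (idm B); split; rewrite /= ?ee ?d0 comp_idl.
split=> //; split=> // Y f [k [kl kr]].
(* In a 2-groupoid the horizontal domain and codomain agree on objects: both are
   the inverse of the unit. *)
have dk : fob (gdom Y) = k.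
{ have := f_equal (@fob _ _ _) (gdom_unit Y) => /= dY.
  by rewrite -[LHS]comp_idr -kr comp_assoc dY comp_idl. }
have ck : fob (gcod Y) = k.
{ have := f_equal (@fob _ _ _) (gcod_unit Y) => /= cY.
  by rewrite -[LHS]comp_idr -kr comp_assoc cY comp_idl. }
have fd : fob (gdom Y) ∘ fob (farr f) = fob (fob f) ∘ fob (gdom D).
{ exact: (f_equal (@fob _ _ _) (fdom f)). }
have fc : fob (gcod Y) ∘ fob (farr f) = fob (fob f) ∘ fob (gcod D).
{ exact: (f_equal (@fob _ _ _) (fcod f)). }
have [y yE] : exists y, y ∘ q = fob (fob f).
{ by apply: (coequalizer_desc cq); rewrite -fd -fc dk ck. }
case: (co0 _ (fob f) y (eq_sym yE)) => g0 [g0y g0E].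
case: (co1 _ (farr f) (fob (gunit Y) ∘ y)) => [|g1 [g1y g1E]].
{ rewrite -comp_assoc [y ∘ _]comp_assoc yE -fd dk comp_assoc.
  by rewrite kr comp_idl. }
have gd : gdom Y ∘ g1 = g0 ∘ d.
{ by apply: h1epi; rewrite -!comp_assoc g1E dE fdom comp_assoc g0E. }
have gc : gcod Y ∘ g1 = g0 ∘ c.
{ by apply: h1epi; rewrite -!comp_assoc g1E cE fcod comp_assoc g0E. }
have gu : g1 ∘ e = gunit Y ∘ g0.
{ by apply: h0epi; rewrite -!comp_assoc g0E eE comp_assoc g1E funit. }
exists (@graph_functor _ (grpd_heap H) G Y g0 g1 gd gc gu).
exact: gfunctor_eq.
Qed.

(** The given reflection F is a retract, under D, of any 2-groupoid G through
    which every map from D to a 2-groupoid factors, and discrete fibrations descend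
    along the resulting split monomorphism F -> G. *)
Theorem proposition3p2 (C : category) (exactC : is_exact C)
  (maltsevC : naturally_maltsev C) (coeqC : has_coequalizers C)
  (D F : Grpd2 C) (eta : Hom D F)
  (reflF : is_reflection (@is_2groupoid C) eta) :
  discrete_fibration (fob eta) /\ discrete_fibration (farr eta).
Proof.
case: (discrete_fibration_to_2groupoid (naturally_maltsev_heap maltsevC)
         exactC coeqC D) => G [eta' [G2 [df0 [df1 weak]]]].
case: reflF => F2 univ.
case: (univ G eta' G2) => k [kE _].
case: (weak F eta F2) => j jE.
have jk : j ∘ k = idm F.
{ case: (univ F eta F2) => u [_ uniq].
  have <- : u = j ∘ k by apply: uniq; rewrite -comp_assoc kE.
  by apply: uniq; rewrite comp_idl. }
split.
- apply: (@discrete_fibration_of_comp C _ _ _ (fob eta) (fob k) (fob j)).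
  + exact: (f_equal (@fob _ _ _) jk).
  + by rewrite -kE in df0.
- apply: (@discrete_fibration_of_comp C _ _ _ (farr eta) (farr k) (farr j)).
  + exact: (f_equal (@farr _ _ _) jk).
  + by rewrite -kE in df1.
Qed.
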